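(* Let $w\in\operatorname{dom}\varphi$, $t>0$, $0<\sigma<1$, $q=w-t\nabla f(w)$, and let $(s,\mu)\in W\times X^*$ be certified at $(w,t)$, i.e. the gap $\mathcal G_{q,t}(w+s,\mu)$ is finite and $$\mathcal G_{q,t}(w+s,\mu)\le\frac{\sigma^2}{2t}\|s\|_W^2 .$$ Set $p=p(w;t)$. Then $$\|s-p\|_W\le\sigma\|s\|_W,\qquad \frac{\|p\|_W}{1+\sigma}\le\|s\|_W\le\frac{\|p\|_W}{1-\sigma},$$ $$(\nabla f(w),s)_W+\varphi(w+s)-\varphi(w)\le-\frac{1-\sigma}{t}\|s\|_W^2 .$$ If $B:W\to W$ is bounded, linear and self-adjoint and $t\|B\|\le1-\sigma$, then $$-\Bigl((\nabla f(w),s)_W+\tfrac12(Bs,s)_W+\varphi(w+s)-\varphi(w)\Bigr)\ge\frac{1-\sigma}{2t}\|s\|_W^2 .$$ In particular, $p=0$ forces $s=0$ and $\mathcal G_{q,t}(w+s,\mu)=0$.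
   Context: $W$ is a real Hilbert space with inner product $(\cdot,\cdot)_W$; $X$ is a real Banach space with continuous dual $X^*$; $T:W\to X$ is bounded and linear with Banach adjoint $T^*:X^*\to W^*$. The dual norm on $W^*$ is $\|\ell\|_{W^*}=\|\mathcal R_W^{-1}\ell\|_W$, where $\mathcal R_W:W\to W^*$ is the Riesz map $\langle\mathcal R_Wu,v\rangle=(u,v)_W$. $R:X\to(-\infty,+\infty]$ is proper, convex, norm lower semicontinuous; $\varphi=R\circ T$ with $\operatorname{dom}\varphi\ne\emptyset$. $f:W\to\mathbb R$ is continuously Fréchet differentiable; its Hilbert gradient, defined by $(\nabla f(w),v)_W=f'(w)[v]$, is globally Lipschitz with constant $L_f\ge0$. The objective $F=f+\varphi$ is bounded below on $\operatorname{dom}\varphi$ by a finite number $F_{\rm low}$. Proximal-gradient step: $p(w;t)=\arg\min_{s\in W}\{(\nabla f(w),s)_W+\frac1{2t}\|s\|_W^2+\varphi(w+s)\}$ (exists and is unique). For $q\in W$, $t>0$: $\Psi_{q,t}(y)=\frac1{2t}\|y-q\|_W^2+R(Ty)$, $D_{q,t}(\mu)=\langle\mu,Tq\rangle-\frac t2\|T^*\mu\|_{W^*}^2-R^*(\mu)$, with $R^*(\mu)=\sup_{x\in X}(\langle\mu,x\rangle-R(x))$, and the gap is $\mathcal G_{q,t}(y,\mu)=\Psi_{q,t}(y)-D_{q,t}(\mu)$; it is finite when $Ty\in\operatorname{dom}R$ and $\mu\in\operatorname{dom}R^*$. *)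

(* Defs.v *)
From HB Require Import structures.
From mathcomp Require Import all_boot all_order all_algebra.
From mathcomp Require Import sesquilinear ring.
From mathcomp Require Import all_classical all_reals.
From mathcomp Require Import ereal topology normedtype landau derive.

Set Implicit Arguments.
Unset Strict Implicit.
Unset Printing Implicit Defensive.

Import Order.TTheory GRing.Theory Num.Theory.
Import numFieldNormedType.Exports.

Local Open Scope classical_set_scope.
Local Open Scope ring_scope.

(* Real Hilbert spaces: Banach spaces whose norm comes from an inner product.
   [{dot W for idfun}] is the library type of symmetric positive definite
   bilinear forms. *)
HB.mixin Record NormedModule_hasInner (R : realType) W
    of CompleteNormedModule R W := {
  inner : {dot W for (@idfun R)} ;
  norm_inner : forall u : W, `|u| = Num.sqrt (inner u u)
}.

#[short(type="hilbertType")]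
HB.structure Definition Hilbert (R : realType) :=
  {W of NormedModule_hasInner R W & CompleteNormedModule R W}.

Section bounded_operators.
Context {R : realType}.

(* A linear map is bounded iff it is continuous: [linear_bounded_continuous]. *)
Record bounded_operator (U V : normedModType R) := BoundedOperator {
  bounded_operator_fun :> {linear U -> V} ;
  bounded_operator_continuous : continuous bounded_operator_fun
}.

Definition opnorm (U V : normedModType R) (A : bounded_operator U V) : R :=
  sup [set `|A u| | u in [set u : U | `|u| <= 1]].

Definition dual (U : normedModType R) := bounded_operator U R^o.

Lemma banach_adjoint_continuous (U V : normedModType R)
    (A : bounded_operator U V) (mu : dual V) :
  continuous (mu \o A : {linear U -> R^o}).
Proof.
by move=> u; apply: continuous_comp; exact: bounded_operator_continuous.
Qed.

Definition banach_adjoint (U V : normedModType R) (A : bounded_operator U V)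
    (mu : dual V) : dual U :=
  BoundedOperator (@banach_adjoint_continuous U V A mu).

End bounded_operators.

Section riesz.
Context {R : realType} {W : hilbertType R}.
Implicit Types u v : W.

Lemma innerC u v : inner u v = inner v u.
Proof. by rewrite (hermC inner) expr0 mul1r. Qed.

Lemma inner_ge0 u : 0 <= inner u u.
Proof.
have [->|u0] := eqVneq u 0; first by rewrite linear0l.
exact/ltW/neq0_dnorm_gt0.
Qed.

Lemma norm_sqr_inner u : `|u| ^+ 2 = inner u u.
Proof. by rewrite norm_inner sqr_sqrtr ?inner_ge0. Qed.

Lemma inner_le_norm u v : `|inner u v| <= `|u| * `|v|.
Proof.
have [->|u0] := eqVneq u 0; first by rewrite linear0l !normr0 mul0r.
have uu : 0 < inner u u by exact: neq0_dnorm_gt0.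
have := inner_ge0 (inner u u *: v - inner u v *: u).
rewrite !(linearBl, linearBr, linearZl_LR, linearZr_LR) /=.
rewrite [inner v u]innerC.
set a := inner u u in uu *; set b := inner u v; set c := inner v v => H.
have : 0 <= a * (a * c - b ^+ 2).
  apply: le_trans H _; rewrite le_eqVlt; apply/orP; left; apply/eqP.
  by rewrite /GRing.scale /=; ring.
rewrite pmulr_rge0// subr_ge0 => H'.
rewrite -(@ler_pXn2r _ 2) ?nnegrE ?mulr_ge0//.
by rewrite exprMn !norm_sqr_inner -normrX ger0_norm// sqr_ge0.
Qed.

Lemma inner_continuous u : continuous (inner u : {linear W -> R^o}).
Proof.
apply: bounded_linear_continuous.
apply/linear_boundedP; near=> r.
have ur : `|u| <= r by near: r; exact: nbhs_pinfty_ge.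
by move=> v; rewrite (le_trans (inner_le_norm u v))// ler_wpM2r.
Unshelve. all: by end_near. Qed.

Definition riesz u : dual W := BoundedOperator (@inner_continuous u).

(* The inverse of the Riesz map; [get] picks the unique element of the set. *)
Definition riesz_inv (l : dual W) : W := get [set u | riesz u =1 l].

Definition dual_norm (l : dual W) : R := `|riesz_inv l|.

Definition gradient (f : W -> R^o) (w : W) : W :=
  get [set g | forall v, inner g v = 'd f w v].

Definition self_adjoint (B : bounded_operator W W) :=
  forall u v, inner (B u) v = inner u (B v).

End riesz.

(* Frechet differentiability with a derivative continuous for the operator
   norm of the dual. *)
Definition continuously_differentiable (R : realType) (U : normedModType R)
    (f : U -> R^o) :=
  (forall u, differentiable f u) /\
  (forall (u : U) (e : R), 0 < e ->
    \forall u' \near u, forall v, `|'d f u' v - 'd f u v| <= e * `|v|).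

Section extended_functionals.
Context {R : realType} {X : normedModType R}.
Local Open Scope ereal_scope.
Implicit Types g : X -> \bar R.

Definition edom g : set X := [set x | g x < +oo].

Definition proper_efun g := (forall x, g x != -oo) /\ edom g !=set0.

Definition convex_efun g := forall (x y : X) (l : R), (0 <= l <= 1)%R ->
  g (l *: x + (1 - l) *: y)%R <= l%:E * g x + (1 - l)%:E * g y.

Definition convex_conjugate g (mu : dual X) : \bar R :=
  ereal_sup [set (mu x)%:E - g x | x in [set: X]].

End extended_functionals.

Section proximal_gradient.
Context {R : realType} {W : hilbertType R} {X : completeNormedModType R}.
Variables (T : bounded_operator W X) (reg : X -> \bar R).
Local Open Scope ereal_scope.

Definition prox_model (f : W -> R^o) (phi : W -> \bar R) (w : W) (t : R)
    (s : W) : \bar R :=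
  (inner (gradient f w) s + (2 * t)^-1 * `|s| ^+ 2)%:E + phi (w + s)%R.

(* A minimizer of the model, which exists and is unique under the standing
   assumptions. *)
Definition prox_step (f : W -> R^o) (phi : W -> \bar R) (w : W) (t : R) : W :=
  get [set p | forall s, prox_model f phi w t p <= prox_model f phi w t s].

Definition primal_obj (q : W) (t : R) (y : W) : \bar R :=
  ((2 * t)^-1 * `|y - q| ^+ 2)%:E + reg (T y).

Definition dual_obj (q : W) (t : R) (mu : dual X) : \bar R :=
  (mu (T q) - t / 2 * dual_norm (banach_adjoint T mu) ^+ 2)%:E
  - convex_conjugate reg mu.

Definition gap (q : W) (t : R) (y : W) (mu : dual X) : \bar R :=
  primal_obj q t y - dual_obj q t mu.

Definition certified (f : W -> R^o) (sigma : R) (w : W) (t : R)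
    (s : W) (mu : dual X) :=
  let q := (w - t *: gradient f w)%R in
  gap q t (w + s)%R mu \is a fin_num /\
  gap q t (w + s)%R mu <= (sigma ^+ 2 / (2 * t) * `|s| ^+ 2)%:E.

End proximal_gradient.

(* Main.v *)
Require Import Defs.
From mathcomp Require Import all_boot all_order all_algebra.
From mathcomp Require Import sesquilinear ring lra.
From mathcomp Require Import all_classical all_reals.
From mathcomp Require Import ereal topology normedtype landau derive.
Import Order.TTheory GRing.Theory Num.Theory.
Import numFieldNormedType.Exports.
Local Open Scope classical_set_scope.
Local Open Scope ring_scope.

(** Write g for the gradient of f at w, and u for the Riesz representative of
    T^* mu.  Up to an additive constant, the proximal model at a step s is the
    primal objective Psi at y = w + s, so w + p minimizes Psi.  Completing the
    square splits the gap into two nonnegative parts,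

      gap(y, mu) = (R(Ty) + R^*(mu) - <mu, Ty>) + |y - q + t u|^2 / (2t),

    the Fenchel-Young defect and a dual residual ([gapE]).  The theorem comes
    from reading this bound on the gap in two ways.

    - Through p.  Weak duality makes the dual value a lower bound for
      Psi(w + p), and Psi is the sum of |y - q|^2 / (2t) and a convex function,
      so it grows quadratically away from its minimizer.  Hence
      |s - p|^2 / (2t) <= gap(w + s, mu) ([dist_minimizer_le_gap]), which gives
      |s - p| <= sigma |s|; the two-sided comparison of the norms follows by the
      triangle inequality.

    - Without p.  Comparing the Fenchel-Young inequality at Tw with the defect e
      at T(w + s) gives phi(w + s) - phi(w) <= (u, s) + e.  With the residual
      d = s + t (g + u), this bounds (g, s) + phi(w + s) - phi(w) by
      ((d, s) - |s|^2) / t + e, while the certificate says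
      2 t e + |d|^2 <= sigma^2 |s|^2.  The worst case is |d| = sigma |s|, e = 0,
      which yields the decrease - (1 - sigma) |s|^2 / t
      ([certified_decrease]).  A quadratic term with t ||B|| <= 1 - sigma
      consumes at most half of that decrease.

    If p = 0 then |s| <= sigma |s| forces s = 0, and then weak duality and
    the certificate squeeze the gap to 0.

    Two existence facts are needed: a minimizer of the proximal model, and the
    Riesz representative of T^* mu.  Both come from one result: on a Banach
    space, a strongly convex lower semicontinuous functional that is proper and
    bounded below attains its minimum ([strongly_convex_minimizer]).  In the
    Riesz case the functional is |v|^2 / 2 - l(v); in the proximal case it is
    Psi, and the lower bound is the dual value of mu. *)

(** * Strongly convex functionals *)

(** The modulus is normalized so that c |y - q|^2 plus a convex function has
    modulus c, whence c = 1 / (2t) for the primal objective. *)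
Definition strongly_convex {R : realType} {V : normedModType R} (c : R)
    (J : V -> \bar R) :=
  forall (a b : V) (l : R), 0 <= l <= 1 ->
    (J (l *: a + (1 - l) *: b)%R + (c * (l * (1 - l)) * `|a - b| ^+ 2)%:E
      <= l%:E * J a + (1 - l)%:E * J b)%E.

(** The midpoint inequality bounds the squared diameter of the sublevel set
    {J < inf J + e} by 4 e / c, so the sublevel sets generate a Cauchy filter.
    Lower semicontinuity shows that J attains its infimum at the limit. *)
Lemma strongly_convex_minimizer {R : realType} {V : completeNormedModType R}
    {c : R} {J : V -> \bar R} {m : R} :
    0 < c -> strongly_convex c J -> lower_semicontinuous J ->
    (forall y, (m%:E <= J y)%E) -> edom J !=set0 ->
  exists y, forall z, (J y <= J z)%E.
Proof.
move=> c0 Jc Jl mJ [y0 /= Jy0].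
set S := range J; set i := ereal_inf S.
have i_fin : i \is a fin_num.
  rewrite fin_numE; apply/andP; split.
    have : (m%:E <= i)%E by apply: le_ereal_inf_tmp => _ [y _ <-].
    by case: (i).
  have : (i <= J y0)%E by apply: ereal_inf_lbound; exists y0.
  by move=> /le_lt_trans/(_ Jy0); case: (i).
have iJ y : (i <= J y)%E by apply: ereal_inf_lbound; exists y.
pose B (e : R) := [set y | (J y < i + e%:E)%E].
have Bne e : 0 < e -> B e !=set0.
  move=> e0; have [_ [y _ <-] ?] := lb_ereal_inf_adherent e0 i_fin.
  by exists y.
have Bclose a b e : B e a -> B e b -> c / 4 * `|a - b| ^+ 2 <= e.
  rewrite /B /= => Ba Bb.
  (* the two values below i + e and the one at the midpoint, at least i, leave
     room for a quadratic term at most e *)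
  have h : 0 <= (2^-1 : R) <= 1 by apply/andP; split; lra.
  have := Jc a b 2^-1 h; have := iJ (2^-1 *: a + (1 - 2^-1) *: b).
  move: Ba Bb (iJ a) (iJ b); rewrite -(fineK i_fin).
  case: (J a) => [ra||] //; case: (J b) => [rb||] //.
  case: (J _) => [rc||] //=.
  by rewrite -!EFinD !lte_fin !lee_fin; nra.
pose F := filter_from [set e : R | 0 < e] B.
have F_filter : ProperFilter F.
  apply: filter_from_proper; last by move=> e /Bne.
  apply: filter_from_filter; first by exists 1; exact: ltr01.
  move=> e1 e2 /= e10 e20; exists (Num.min e1 e2) => /=.
    by rewrite lt_min e10.
  move=> y; rewrite /B /= => Jy; split; apply: lt_le_trans Jy _.
    by rewrite leeD2l// lee_fin ge_min lexx.
  by rewrite leeD2l// lee_fin ge_min lexx orbT.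
have /cauchy_cvgP F_cvg : cauchy F.
  apply: cauchy_exP => e e0.
  (* half the level at which the diameter bound equals e, to get a strict < *)
  pose d := c / 4 * e ^+ 2 / 2.
  have ce0 : 0 < c * e ^+ 2 by rewrite mulr_gt0 ?exprn_gt0.
  have d0 : 0 < d by rewrite /d; lra.
  have [x Bx] := Bne d d0.
  exists x; exists d => // y By; rewrite -ball_normE /=.
  rewrite -(@ltr_pXn2r _ 2) ?nnegrE ?normr_ge0 ?ltW//.
  have := Bclose x y d Bx By; rewrite /d => h.
  rewrite -(ltr_pM2l c0); lra.
exists (lim F) => z; apply: le_trans (iJ z).
rewrite leNgt; apply/negP => iJlim.
have [r ir rJ] : exists2 r : R, (i < r%:E)%E & (r%:E < J (lim F))%E.
  move: iJlim; rewrite -(fineK i_fin); case: (J _) => [rl||] //.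
  - rewrite lte_fin => h; exists ((fine i + rl) / 2); rewrite lte_fin; lra.
  - move=> _; exists (fine i + 1); rewrite ?ltry// lte_fin; lra.
have [U U_lim UJ] := Jl _ _ rJ.
have [e /= e0 eU] : F U by exact: F_cvg.
pose d := Num.min e (r - fine i).
have d0 : 0 < d.
  by rewrite lt_min e0 subr_gt0; move: ir; rewrite -{1}(fineK i_fin) lte_fin.
have [y By] := Bne d d0.
have /UJ : U y.
  by apply: eU; apply: lt_le_trans By _; rewrite leeD2l// lee_fin ge_min lexx.
apply/negP; rewrite -leNgt; apply/ltW/(lt_le_trans By).
rewrite -(fineK i_fin) -EFinD lee_fin /d.
have : Num.min e (r - fine i) <= r - fine i by rewrite ge_min lexx orbT.
lra.
Qed.

(** Strong convexity on the segment from y to z, together with the minimality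
    of y, gives (1 - l) c |z - y|^2 <= J z - J y for every l in (0, 1); the
    claim is the limit l -> 0. *)
Lemma strongly_convex_growth {R : realType} {V : normedModType R} {c : R}
    {J : V -> \bar R} {y : V} :
    0 < c -> strongly_convex c J -> J y \is a fin_num ->
    (forall z, (J y <= J z)%E) ->
  forall z, (J y + (c * `|z - y| ^+ 2)%:E <= J z)%E.
Proof.
move=> c0 Jc Jy_fin y_min z.
have := y_min z; case Jz : (J z) => [jz||]; rewrite ?leey//; last first.
  by rewrite -(fineK Jy_fin).
rewrite -(fineK Jy_fin) -EFinD !lee_fin => yz.
rewrite leNgt; apply/negP => zy.
set d := c * `|z - y| ^+ 2 in zy.
have d_ge0 : 0 <= d by rewrite mulr_ge0 ?sqr_ge0 ?ltW.
have d0 : 0 < d by lra.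
(* this l makes (1 - l) d the average of d and J z - J y, so that
   (1 - l) d > J z - J y *)
pose l := (d - (jz - fine (J y))) / (2 * d).
have ld : l * (2 * d) = d - (jz - fine (J y)) by rewrite /l mulfVK//; lra.
have l0 : 0 < l by rewrite /l divr_gt0; lra.
have l1 : l <= 1 by nra.
have := Jc z y l; rewrite (ltW l0) l1 => /(_ isT).
have := y_min (l *: z + (1 - l) *: y); rewrite Jz -(fineK Jy_fin).
case: (J (_ + _)) => [jc||] //.
rewrite -!EFinM -!EFinD !lee_fin => h1.
rewrite (_ : c * (l * (1 - l)) * _ = l * (1 - l) * d); last by rewrite /d; ring.
move=> h2.
have : l * ((1 - l) * d) <= l * (jz - fine (J y)) by nra.
rewrite ler_pM2l//; nra.
Qed.

(** * Bounded operators and lower semicontinuity *)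

Lemma bounded_operator_bound {R : realType} {U V : normedModType R}
    (A : bounded_operator U V) :
  exists2 C, 0 <= C & forall u, `|A u| <= C * `|u|.
Proof.
have : bounded_near A (nbhs (0 : U)).
  exact/linear_bounded_continuous/bounded_operator_continuous.
move/linear_boundedP => Abnd.
near (pinfty_nbhs R) => C; exists C; last by near: C.
by near: C; exact: nbhs_pinfty_ge.
Unshelve. all: by end_near. Qed.

Lemma norm_le_opnorm {R : realType} {U V : normedModType R}
    (A : bounded_operator U V) (u : U) : `|A u| <= opnorm A * `|u|.
Proof.
have [->|u0] := eqVneq u 0; first by rewrite linear0 !normr0 mulr0.
have nu0 : 0 < `|u| by rewrite normr_gt0.
rewrite -ler_pdivrMr//.
have -> : `|A u| / `|u| = `|A (`|u|^-1 *: u)|.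
  by rewrite linearZ /= normrZ normfV normr_id mulrC.
apply: sup_upper_bound; last first.
  by exists (`|u|^-1 *: u) => //=; rewrite normrZ normfV normr_id mulVf ?gt_eqF.
split; first by exists `|A 0|, 0 => //=; rewrite normr0.
have [C C0 AC] := bounded_operator_bound A.
exists C => _ [v /= v1 <-]; apply: le_trans (AC v) _.
by rewrite ler_piMr.
Qed.

(** The slack in a < g x + psi x is shared: b is a level strictly below psi x,
    and d is the room left for the variation of g. *)
Lemma lower_semicontinuousD_continuous {R : realType} {V : topologicalType}
    (g : V -> R^o) (psi : V -> \bar R) :
    continuous g -> lower_semicontinuous psi ->
  lower_semicontinuous (fun y => ((g y)%:E + psi y)%E).
Proof.
move=> g_cont psi_lsc x a ax.
have [b [d [d0 agx bpsi]]] :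
    exists b d : R, [/\ 0 < d, a <= g x - d + b & (b%:E < psi x)%E].
  move: ax; case: (psi x) => [r||] //.
  - rewrite -EFinD lte_fin => ?; pose d := (g x + r - a) / 2.
    by exists (r - d), d; rewrite lte_fin /d; split; lra.
  - by exists (a - g x + 1), 1; rewrite ltry; split => //; lra.
have [U U_x Upsi] := psi_lsc _ _ bpsi.
exists ([set y | g x - d < g y] `&` U); last first.
  move=> y [/= gy /Upsi]; case: (psi y) => [r||] //.
    by rewrite -EFinD !lte_fin => ?; lra.
  by move=> _; exact: ltry.
apply: filterI U_x; apply: (cvgr_gt (g x)); first exact: g_cont.
lra.
Qed.

(** * Hilbert spaces *)

Section hilbert.
Context {R : realType} {W : hilbertType R}.
Implicit Types u v a b q : W.

Lemma norm_sqrD u v : `|u + v| ^+ 2 = `|u| ^+ 2 + 2 * inner u v + `|v| ^+ 2.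
Proof.
rewrite !norm_sqr_inner !(linearDl, linearDr) /= (innerC v u); ring.
Qed.

Lemma norm_sqrZ (k : R) u : `|k *: u| ^+ 2 = k ^+ 2 * `|u| ^+ 2.
Proof. by rewrite normrZ exprMn real_normK ?num_real. Qed.

Lemma innerZr u v (k : R) : inner u (k *: v) = k * inner u v.
Proof. by rewrite linearZr_LR. Qed.

Lemma innerZl u v (k : R) : inner (k *: u) v = k * inner u v.
Proof. by rewrite innerC innerZr innerC. Qed.

Lemma norm_sqrB u v : `|u - v| ^+ 2 = `|u| ^+ 2 - 2 * inner u v + `|v| ^+ 2.
Proof. by rewrite norm_sqrD normrN -scaleN1r innerZr; ring. Qed.

(** This identity is where the inner product enters the strong convexity: the
    defect of convexity of |. - q|^2 does not depend on q. *)
Lemma norm_sqr_convex q a b (l : R) :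
  `|l *: a + (1 - l) *: b - q| ^+ 2
  = l * `|a - q| ^+ 2 + (1 - l) * `|b - q| ^+ 2 - l * (1 - l) * `|a - b| ^+ 2.
Proof.
have -> : l *: a + (1 - l) *: b - q = l *: (a - q) + (1 - l) *: (b - q).
  by rewrite !scalerBr addrACA -opprD -scalerDl subrKC scale1r.
have -> : a - b = (a - q) - (b - q) by rewrite opprB addrA subrK.
rewrite (norm_sqrD (l *: _)) (norm_sqrB (a - q)) !norm_sqrZ.
by rewrite innerZl innerZr; ring.
Qed.

Lemma strongly_convex_quadD (c : R) q (psi : W -> \bar R) :
    (forall y, psi y != -oo%E) -> convex_efun psi ->
  strongly_convex c (fun y => ((c * `|y - q| ^+ 2)%:E + psi y)%E).
Proof.
move=> psiN psi_convex a b l /[dup] l01 /andP[l0 l1].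
rewrite norm_sqr_convex; have := psi_convex a b l l01.
have := psiN (l *: a + (1 - l) *: b).
move: (psiN a) (psiN b).
(* the end points are treated apart: there an infinite value of psi is
   multiplied by 0 *)
have [->|l_neq0] := eqVneq l 0.
  rewrite subr0 !mul0e !add0e !mul1e scale0r add0r scale1r => _ _.
  case: (psi b) => [pb||] // _ _; rewrite -?EFinM -?EFinD lee_fin; lra.
have [->|l_neq1] := eqVneq l 1.
  rewrite subrr !mul0e !adde0 !mul1e scale0r addr0 scale1r => _ _.
  case: (psi a) => [pa||] // _ _; rewrite -?EFinM -?EFinD lee_fin; lra.
have {}l0 : 0 < l by rewrite lt_neqAle eq_sym l_neq0.
have {}l1 : 0 < 1 - l by rewrite subr_gt0 lt_neqAle l_neq1.
case: (psi a) => [pa||] // _; case: (psi b) => [pb||] // _;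
  rewrite ?(addey, addye)//= ?gt0_muley ?lte_fin// ?(addey, addye) ?leey//.
case: (psi _) => [pc||] //= _.
rewrite -?EFinM -?EFinD !lee_fin; lra.
Qed.

Lemma quad_continuous (c : R) q : continuous (fun y => c * `|y - q| ^+ 2 : R^o).
Proof.
have norm_cont : continuous (fun y => `|y - q|).
  move=> y; apply: cvg_norm; apply: cvgB; [exact: cvg_id|exact: cvg_cst].
move=> y; apply: cvgM; first exact: cvg_cst.
by rewrite expr2; under eq_cvg do rewrite expr2; apply: cvgM; exact: norm_cont.
Qed.

(** The representative is the minimizer u of |v|^2 / 2 - l(v).  Quadratic growth
    at u, tested at u + z, has the same |z|^2 / 2 on both sides; what remains is
    l z <= (u, z), and replacing z by -z gives equality. *)
Lemma riesz_representation (l : dual W) : exists u : W, riesz u =1 l.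
Proof.
have [C C0 lC] := bounded_operator_bound l.
pose J (v : W) := ((2^-1 * `|v - 0| ^+ 2)%:E + (- l v)%:E)%E.
have Jc : strongly_convex (2^-1) J.
  apply: strongly_convex_quadD => [y //|x y k _].
  by rewrite linearD !linearZ /= -!EFinM -EFinD lee_fin /GRing.scale /=; lra.
have Jl : lower_semicontinuous J.
  apply: lower_semicontinuousD_continuous => [|x a].
    exact: quad_continuous.
  rewrite lte_fin => ax.
  exists [set y | a < - l y]; last by move=> y; rewrite /= lte_fin.
  apply: open_nbhs_nbhs; split => //.
  apply: (@open_comp _ _ (fun y => - l y) [set z | a < z]); last exact: open_gt.
  move=> y _; apply: continuousN; exact: bounded_operator_continuous.
(* the minimum over r of r^2 / 2 - C r is - C^2 / 2 *)
have Jm y : ((- (C ^+ 2 / 2))%:E <= J y)%E.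
  rewrite /J -EFinD lee_fin subr0.
  have := lC y; rewrite ler_norml => /andP[_ ?].
  have := sqr_ge0 (`|y| - C); nra.
have Jdom : edom J !=set0 by exists 0; rewrite /edom /= /J -EFinD ltry.
have h0 : 0 < (2^-1 : R) by lra.
have [u u_min] := strongly_convex_minimizer h0 Jc Jl Jm Jdom.
have Ju : J u \is a fin_num by rewrite /J -EFinD.
have growth := strongly_convex_growth h0 Jc Ju u_min.
have l_le z : l z <= inner u z.
  have := growth (u + z).
  rewrite /J -!EFinD lee_fin !subr0 (addrAC u z) subrr add0r.
  rewrite norm_sqrD linearD /=.
  lra.
exists u => z; apply/eqP; rewrite eq_le l_le andbT.
by have := l_le (- z); rewrite !linearN lerN2.
Qed.

End hilbert.

Lemma riesz_invP {R : realType} {W : hilbertType R} (l : dual W) (v : W) :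
  inner (riesz_inv l) v = l v.
Proof. exact: (getPex (riesz_representation l)). Qed.

(** * Fenchel duality for the proximal subproblem *)

Section duality.
Context {R : realType} {W : hilbertType R} {X : completeNormedModType R}.
Context {T : bounded_operator W X} {reg : X -> \bar R}.
Implicit Types (q w y z s : W) (t : R) (mu : dual X).

Lemma fenchel_young {mu} {k : R} (x : X) :
  convex_conjugate reg mu = k%:E -> ((mu x - k)%:E <= reg x)%E.
Proof.
move=> mu_k; have : ((mu x)%:E - reg x <= k%:E)%E.
  by rewrite -mu_k; apply: ereal_sup_ubound; exists x.
case: (reg x) => [r||]//=; last by rewrite leey.
rewrite -EFinB !lee_fin; lra.
Qed.

(** Neither reg nor its conjugate takes the value -oo, so no cancellation of
    infinities can make the gap finite. *)
Lemma gap_fin_num {q t y mu} : proper_efun reg ->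
    gap T reg q t y mu \is a fin_num ->
  exists r k, reg (T y) = r%:E /\ convex_conjugate reg mu = k%:E.
Proof.
move=> [regN [x0 /= x0_dom]]; rewrite /gap /primal_obj /dual_obj.
have : convex_conjugate reg mu != -oo%E.
  have : ((mu x0)%:E - reg x0 <= convex_conjugate reg mu)%E.
    by apply: ereal_sup_ubound; exists x0.
  move: x0_dom (regN x0); rewrite /edom /=.
  by case: (reg x0) => [r||] // _ _; case: (convex_conjugate reg mu).
move: (regN (T y)); case: (reg (T y)) => [r||] // _;
  case: (convex_conjugate reg mu) => [k||] // _ _.
by exists r, k.
Qed.

Lemma dual_objE {q t mu} {k : R} (u := riesz_inv (banach_adjoint T mu)) :
    convex_conjugate reg mu = k%:E ->
  dual_obj T reg q t mu = (inner u q - t / 2 * `|u| ^+ 2 - k)%:E.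
Proof. by rewrite /dual_obj => ->; rewrite -EFinB /u riesz_invP. Qed.

(** Completing the square in |y - q|^2 / (2t) - (u, q) + t |u|^2 / 2 leaves
    - (u, y) = - <mu, Ty>, which completes the Fenchel-Young defect. *)
Lemma gapE {q t y mu} {r k : R} (u := riesz_inv (banach_adjoint T mu)) :
    0 < t -> reg (T y) = r%:E -> convex_conjugate reg mu = k%:E ->
  gap T reg q t y mu =
    (r + k - mu (T y) + (2 * t)^-1 * `|y - q + t *: u| ^+ 2)%:E.
Proof.
move=> t0 y_r mu_k; rewrite /gap (dual_objE mu_k) /primal_obj y_r.
rewrite -!(EFinB, EFinD); congr EFin.
have -> : mu (T y) = inner u y by rewrite /u riesz_invP.
rewrite (norm_sqrD (y - q)) norm_sqrZ innerZr (innerC _ u) linearBr /= -/u.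
field; lra.
Qed.

Lemma weak_duality {q t mu} {k : R} z : 0 < t ->
    convex_conjugate reg mu = k%:E ->
  (dual_obj T reg q t mu <= primal_obj T reg q t z)%E.
Proof.
move=> t0 mu_k; have := fenchel_young (T z) mu_k.
case z_r : (reg (T z)) => [r||] //; last first.
  by rewrite /primal_obj z_r addey// !leey.
rewrite lee_fin => rk; rewrite -sube_ge0; last by rewrite (dual_objE mu_k).
rewrite -/(gap _ _ _ _ _ _) (gapE t0 z_r mu_k) lee_fin addr_ge0//; first lra.
by rewrite mulr_ge0 ?sqr_ge0// invr_ge0 mulr_ge0// ltW.
Qed.

Lemma strongly_convex_primal q t : proper_efun reg -> convex_efun reg ->
  strongly_convex (2 * t)^-1 (primal_obj T reg q t).
Proof.
move=> [regN _] reg_convex; apply: strongly_convex_quadD => // a b l l01.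
by rewrite linearD !linearZ; exact: reg_convex.
Qed.

(** The dual value of mu is the lower bound that existence requires. *)
Lemma primal_minimizer {q t mu} {k : R} : 0 < t ->
    proper_efun reg -> convex_efun reg -> lower_semicontinuous reg ->
    edom (reg \o T) !=set0 -> convex_conjugate reg mu = k%:E ->
  exists y, forall z, (primal_obj T reg q t y <= primal_obj T reg q t z)%E.
Proof.
move=> t0 reg_proper reg_convex reg_lsc [y0 y0_dom] mu_k.
have c0 : 0 < (2 * t)^-1 by rewrite invr_gt0 mulr_gt0.
apply: (strongly_convex_minimizer c0 (strongly_convex_primal _ _ _ _)) => //.
- apply: lower_semicontinuousD_continuous; first exact: quad_continuous.
  move=> x a ax; have [V V_Tx Va] := reg_lsc _ _ ax.
  exists (T @^-1` V); last by move=> y; exact: Va.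
  exact: bounded_operator_continuous.
- move=> z; have := weak_duality (q := q) z t0 mu_k.
  by rewrite (dual_objE mu_k); exact.
- exists y0; move: y0_dom; rewrite /edom /= /primal_obj.
  by case: (reg (T y0)) => [r||] // _; rewrite -EFinD ltry.
Qed.

(** Since w + s - q = s + t g, the two quadratic terms differ by the constant
    t |g|^2 / 2. *)
Lemma prox_modelE (f : W -> R^o) w t s : 0 < t ->
  prox_model f (reg \o T) w t s =
  (primal_obj T reg (w - t *: gradient f w)%R t (w + s)%R
   - (t / 2 * `|gradient f w| ^+ 2)%:E)%E.
Proof.
move=> t0; rewrite /prox_model /primal_obj /=.
rewrite opprB addrCA [w + s - w]addrAC subrr add0r [_ *: _ + s]addrC.
rewrite norm_sqrD norm_sqrZ innerZr (innerC s).
case: (reg (T (w + s))) => [r||] //.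
by rewrite -!(EFinB, EFinD); congr EFin; field; lra.
Qed.

(** The step [prox_step] is chosen among the minimizers of the model, hence
    means something only once a minimizer exists; the finite conjugate value at
    mu provides it. *)
Lemma prox_step_minimizes_primal {mu} {k : R} (f : W -> R^o) w t
    (q := w - t *: gradient f w) :
    0 < t -> proper_efun reg -> convex_efun reg -> lower_semicontinuous reg ->
    edom (reg \o T) !=set0 -> convex_conjugate reg mu = k%:E ->
  forall z, (primal_obj T reg q t (w + prox_step f (reg \o T) w t)%R
             <= primal_obj T reg q t z)%E.
Proof.
move=> t0 reg_proper reg_convex reg_lsc dom mu_k.
have [y y_min] :=
  @primal_minimizer q _ _ _ t0 reg_proper reg_convex reg_lsc dom mu_k.
have prox_ex : exists p, forall s,
    (prox_model f (reg \o T) w t p <= prox_model f (reg \o T) w t s)%E.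
  exists (y - w) => s; rewrite !prox_modelE// subrKC leeD2r//.
move=> z; have := getPex prox_ex (z - w).
by rewrite !prox_modelE// subrKC leeD2rE.
Qed.

(** By weak duality the gap at y is at least the excess of the primal objective
    over its minimum, to which quadratic growth applies. *)
Lemma dist_minimizer_le_gap {q t y ybar mu} : 0 < t ->
    proper_efun reg -> convex_efun reg ->
    (forall z, (primal_obj T reg q t ybar <= primal_obj T reg q t z)%E) ->
    gap T reg q t y mu \is a fin_num ->
  (((2 * t)^-1 * `|y - ybar| ^+ 2)%:E <= gap T reg q t y mu)%E.
Proof.
move=> t0 reg_proper reg_convex ybar_min.
move=> /(gap_fin_num reg_proper) [r [k [y_r mu_k]]].
have c0 : 0 < (2 * t)^-1 by rewrite invr_gt0 mulr_gt0.
have primal_y : primal_obj T reg q t y \is a fin_num.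
  by rewrite /primal_obj y_r.
have primal_ybar : primal_obj T reg q t ybar \is a fin_num.
  have := weak_duality ybar t0 mu_k (q := q); have := ybar_min y.
  rewrite -(fineK primal_y) (dual_objE mu_k).
  by case: (primal_obj T reg q t ybar).
have := strongly_convex_growth c0
  (@strongly_convex_primal q t reg_proper reg_convex) primal_ybar ybar_min y.
have := weak_duality ybar t0 mu_k (q := q).
rewrite /gap (dual_objE mu_k) -(fineK primal_y) -(fineK primal_ybar).
rewrite -EFinD -EFinB !lee_fin; lra.
Qed.

(** * Consequences of a certificate *)

(** The proximal step does not occur here: the dual certificate mu gives a
    subgradient-like bound on phi(w + s) - phi(w), and the dual residual d
    measures how far -(g + u) is from s / t. *)
Lemma certified_decrease (f : W -> R^o) (sigma : R) w t s mu : 0 < t ->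
    0 < sigma -> sigma < 1 -> proper_efun reg ->
    certified T reg f sigma w t s mu ->
  ((inner (gradient f w) s)%:E + reg (T (w + s)%R) - reg (T w)
     <= (- ((1 - sigma) / t * `|s| ^+ 2))%:E)%E.
Proof.
move=> t0 sigma0 sigma1 reg_proper [gap_fin].
have [r [k [y_r mu_k]]] := gap_fin_num reg_proper gap_fin.
rewrite (gapE t0 y_r mu_k) y_r; have := fenchel_young (T (w + s)) mu_k.
have := fenchel_young (T w) mu_k; rewrite y_r.
case: (reg (T w)) => [rw||] //; last by rewrite leNye.
set g := gradient f w; set u := riesz_inv _.
have muT v : mu (T v) = inner u v by rewrite /u riesz_invP.
rewrite !muT -EFinB !lee_fin linearDr /=.
have -> : w + s - (w - t *: g) + t *: u = s + t *: (g + u).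
  rewrite opprB addrCA [w + s - w]addrAC subrr add0r scalerDr addrA.
  by rewrite [t *: g + s]addrC.
set d := s + t *: (g + u) => hw hy hgap.
(* (g + u, s) = (d - s, s) / t by the definition of d *)
have gu_s : inner g s = (inner d s - `|s| ^+ 2) / t - inner u s.
  rewrite /d !linearDl /= innerZl linearDl /= norm_sqr_inner; field; lra.
have := le_trans (ler_norm _) (inner_le_norm d s).
set a := `|d| in hgap *; set b := `|s| in hgap gu_s * => ds.
have a0 : 0 <= a by exact: normr_ge0.
have b0 : 0 <= b by exact: normr_ge0.
set e := r + k - (inner u w + inner u s) in hgap.
have e0 : 0 <= e by rewrite /e; lra.
have ha : 2 * t * e + a ^+ 2 <= sigma ^+ 2 * b ^+ 2.
  have -> : 2 * t * e + a ^+ 2 = 2 * t * (e + (2 * t)^-1 * a ^+ 2).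
    by field; lra.
  have -> : sigma ^+ 2 * b ^+ 2 = 2 * t * (sigma ^+ 2 / (2 * t) * b ^+ 2).
    by field; lra.
  by rewrite ler_pM2l// mulr_gt0.
have ab : a <= sigma * b.
  rewrite -(@ler_pXn2r _ 2) ?nnegrE ?mulr_ge0 ?(ltW sigma0)// exprMn.
  nra.
rewrite gu_s -(ler_pM2l t0).
have -> : t * ((inner d s - b ^+ 2) / t - inner u s + r - rw)
    = inner d s - b ^+ 2 + t * (r - rw - inner u s) by field; lra.
have -> : t * - ((1 - sigma) / t * b ^+ 2) = - ((1 - sigma) * b ^+ 2).
  by field; lra.
have : t * (r - rw - inner u s) <= t * e by rewrite ler_pM2l// /e; lra.
(* 2ab - a^2 = b^2 - (b - a)^2 increases on [0, b], so a = sigma b is the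
   worst case *)
have : ((1 - sigma) * b) ^+ 2 <= (b - a) ^+ 2.
  have sb0 : 0 <= (1 - sigma) * b by rewrite mulr_ge0// subr_ge0 ltW.
  by rewrite ler_pXn2r ?nnegrE//; lra.
lra.
Qed.

Lemma certified_dist_prox_step (f : W -> R^o) (sigma : R) w t s mu : 0 < t ->
    0 < sigma ->
    proper_efun reg -> convex_efun reg -> lower_semicontinuous reg ->
    edom (reg \o T) !=set0 -> certified T reg f sigma w t s mu ->
  `|s - prox_step f (reg \o T) w t| <= sigma * `|s|.
Proof.
move=> t0 sigma0 reg_proper reg_convex reg_lsc dom [gap_fin gap_le].
have [r [k [y_r mu_k]]] := gap_fin_num reg_proper gap_fin.
set p := prox_step _ _ _ _.
have p_min := prox_step_minimizes_primal f w t t0 reg_proper reg_convex reg_lsc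
  dom mu_k.
have := le_trans (dist_minimizer_le_gap t0 reg_proper reg_convex p_min gap_fin)
  gap_le.
rewrite lee_fin -/p opprD addrACA subrr add0r => h.
rewrite -(@ler_pXn2r _ 2) ?nnegrE ?mulr_ge0 ?(ltW sigma0)// exprMn.
have c0 : 0 < (2 * t)^-1 by rewrite invr_gt0 mulr_gt0.
rewrite -(ler_pM2l c0); apply: le_trans h _.
by rewrite [leRHS]mulrA [_^-1 * _]mulrC.
Qed.

Lemma gap_ge0 {q t y mu} : 0 < t -> proper_efun reg ->
  gap T reg q t y mu \is a fin_num -> (0 <= gap T reg q t y mu)%E.
Proof.
move=> t0 reg_proper /(gap_fin_num reg_proper) [r [k [y_r mu_k]]].
rewrite sube_ge0 ?(dual_objE mu_k)// -(dual_objE mu_k).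
exact: weak_duality mu_k.
Qed.

End duality.

Theorem theorem3p4 (R : realType) (W : hilbertType R)
    (X : completeNormedModType R) (T : bounded_operator W X)
    (reg : X -> \bar R)
    (reg_proper : proper_efun reg) (reg_convex : convex_efun reg)
    (reg_lsc : lower_semicontinuous reg)
    (phi : W -> \bar R) (phiE : phi = reg \o T) (phi_dom : edom phi !=set0)
    (f : W -> R^o) (f_C1 : continuously_differentiable f)
    (Lf : R) (Lf_ge0 : 0 <= Lf) (f_lip : Lf.-lipschitz (gradient f))
    (Flow : R)
    (F_low : forall u : W, edom phi u -> (Flow%:E <= (f u)%:E + phi u)%E)
    (w : W) (w_dom : edom phi w) (t : R) (t_gt0 : 0 < t)
    (sigma : R) (sigma_gt0 : 0 < sigma) (sigma_lt1 : sigma < 1)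
    (q : W) (qE : q = w - t *: gradient f w)
    (s : W) (mu : dual X)
    (s_mu_certified : certified T reg f sigma w t s mu)
    (p : W) (pE : p = prox_step f phi w t) :
  [/\ `|s - p| <= sigma * `|s|,
      `|p| / (1 + sigma) <= `|s| <= `|p| / (1 - sigma),
      ((inner (gradient f w) s)%:E + phi (w + s)%R - phi w
        <= (- ((1 - sigma) / t * `|s| ^+ 2))%:E)%E,
      (forall B : bounded_operator W W, self_adjoint B ->
        t * opnorm B <= 1 - sigma ->
        (((1 - sigma) / (2 * t) * `|s| ^+ 2)%:E <=
          - ((inner (gradient f w) s)%:E + (2^-1 * inner (B s) s)%:E
             + phi (w + s)%R - phi w))%E) &
      (p = 0 -> s = 0 /\ gap T reg q t (w + s) mu = 0%E)].
Proof.
have h1 : `|s - p| <= sigma * `|s|.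
  by rewrite pE phiE; apply: certified_dist_prox_step s_mu_certified => //;
    rewrite -phiE.
have h3 : ((inner (gradient f w) s)%:E + phi (w + s)%R - phi w
        <= (- ((1 - sigma) / t * `|s| ^+ 2))%:E)%E.
  by rewrite phiE; exact: certified_decrease s_mu_certified.
case: s_mu_certified => gap_fin gap_le.
have [r [k [y_r mu_k]]] := gap_fin_num reg_proper gap_fin.
split => //.
- have s_le : `|s| <= `|s - p| + `|p| by rewrite -{1}(subrK p s) ler_normD.
  have p_le : `|p| <= `|s - p| + `|s|.
    by rewrite [leRHS]addrC -{1}(subKr s p) ler_normB.
  rewrite ler_pdivrMr ?ler_pdivlMr; lra.
- move=> B _ tB.
  have phi_y : phi (w + s) = r%:E by rewrite phiE.
  have [rw phi_w] : exists rw, phi w = rw%:E.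
    move: w_dom (reg_proper.1 (T w)); rewrite /edom /= phiE /=.
    by case: (reg (T w)) => [rw||] // _ _; exists rw.
  move: h3; rewrite phi_y phi_w -!(EFinB, EFinD) !lee_fin.
  have Bs : inner (B s) s <= opnorm B * `|s| ^+ 2.
    rewrite (le_trans (ler_norm _))// (le_trans (inner_le_norm _ _))//.
    by rewrite expr2 mulrA ler_wpM2r// norm_le_opnorm.
  have tBs : t * inner (B s) s <= (1 - sigma) * `|s| ^+ 2.
    rewrite (le_trans (ler_wpM2l (ltW t_gt0) Bs))// mulrA.
    by rewrite ler_wpM2r// sqr_ge0.
  have {}tBs : inner (B s) s <= (1 - sigma) / t * `|s| ^+ 2.
    by rewrite mulrAC ler_pdivlMr// mulrC.
  have -> : (1 - sigma) / (2 * t) = 2^-1 * ((1 - sigma) / t).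
    by field; rewrite gt_eqF.
  lra.
- move=> p0; have s0 : s = 0.
    apply/eqP; rewrite -normr_le0; move: h1; rewrite p0 subr0.
    have := normr_ge0 s; nra.
  split => //; apply/eqP; rewrite eq_le qE gap_ge0// andbT.
  by rewrite (le_trans gap_le)// s0 normr0 expr0n mulr0.
Qed.
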